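(* Let $n\in\mathbb{N}$, let $0\le x_0<x_1<\cdots<x_n$ be real numbers, $I:=[x_0,x_n]$, and let $p\in[1,\infty)$. For $i\in\{1,\dots,n\}$ let $l_i:I\to[x_{i-1},x_i]$ be a contractive homeomorphism with $l_i(x_0)=x_{i-1}$, $l_i(x_n)=x_i$, whose derivative $Dl_i$ exists and belongs to $L_\infty^+I$. Let $q_1,\dots,q_n\in L_p^+I$ and $S_1,\dots,S_n\in L_\infty^+I$, and define the semi-affine Read–Bajractarević operator $T:L_p^+I\to(\mathbb{R}_0^+)^I$ by $$Tg:=\sum_{i=1}^n (q_i\circ l_i^{-1})\,\chi_{I_i}+\sum_{i=1}^n (S_i\circ l_i^{-1})\cdot(g\circ l_i^{-1})\,\chi_{I_i}.$$ If $$\sum_{i=1}^n \|Dl_i\cdot S_i^p\|_\infty<1,$$ then $T$ maps $L_p^+I$ into itself and is contractive on $(L_p^+I,d_p)$. Its unique fixed point $f^*$ satisfies the self-referential equation $$f^*=\sum_{i=1}^n (q_i\circ l_i^{-1})\,\chi_{I_i}+\sum_{i=1}^n (S_i\circ l_i^{-1})\cdot(f^*\circ l_i^{-1})\,\chi_{I_i},$$ and the graph of $f^*$ is the attractor of the iterated function system on $I\times\mathbb{R}_0^+$ given by the maps $w_i(x,y):=(l_i(x),\,q_i(x)+S_i(x)\,y)$, $i=1,\dots,n$.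
   Context: $\mathbb{R}_0^+:=\{x\in\mathbb{R}:x\ge 0\}$. For $p\in[1,\infty]$, $L_p^+I:=\{f\in L_p(I): f:I\to\mathbb{R}_0^+\}$ (classes of a.e. nonnegative $L_p$-functions), a semi-vector space over $\mathbb{R}_0^+$ under pointwise addition and multiplication by nonnegative scalars. It is endowed with $d_p(f,g):=\int_I(\max\{f(t),g(t)\}-\min\{f(t),g(t)\})^p\,dt$ for $p<\infty$, and $d_\infty(f,g):=\operatorname{ess\,sup}_{t\in I}(\max\{f(t),g(t)\}-\min\{f(t),g(t)\})$; $\|\cdot\|_\infty$ is the essential supremum norm. The subintervals are $I_i:=[x_{i-1},x_i)$ for $i=1,\dots,n-1$ and $I_n:=[x_{n-1},x_n]$, so that $I$ is the disjoint union of the $I_i$; $\chi_{I_i}$ is the characteristic function of $I_i$. An operator is contractive if it is Lipschitz with constant $<1$ with respect to $d_p$. The attractor of an iterated function system $\{w_1,\dots,w_n\}$ is the unique nonempty set $A$ with $A=\bigcup_{i=1}^n w_i(A)$ (fixed point of the associated set-valued map).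
   Formalization: The graph of f* is shown invariant for suitable a.e.-equal representatives of f*, q_i, S_i, and the attractor's uniqueness holds only among graphs of L_p^+ functions (up to a.e. equality), since uniqueness among all nonempty sets is false. *)

(* Defs.v *)
From HB Require Import structures.
From mathcomp Require Import all_boot all_order all_algebra.
From mathcomp Require Import all_classical all_reals all_analysis.
Set Implicit Arguments. Unset Strict Implicit. Unset Printing Implicit Defensive.
Import Order.TTheory GRing.Theory Num.Theory.
Import numFieldNormedType.Exports.
Local Open Scope classical_set_scope.
Local Open Scope ring_scope.

Section Defs.
Variable R : realType.
Local Notation mu := (@lebesgue_measure R).

Definition cI (a b : R) : set R := [set t | a <= t <= b].

Definition Isub (x : nat -> R) (n i : nat) : set R :=
  if (i < n)%N then [set t | x i.-1 <= t < x i] else cI (x i.-1) (x i).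

Definition esssup_on (A : set R) (h : R -> R) : \bar R :=
  ereal_inf [set M : \bar R | {ae mu, forall t, A t -> ((h t)%:E <= M)%E}].

(* representatives of elements of L_p^+ A (p < oo) *)
Definition Lp_plus (p : R) (A : set R) (f : R -> R) : Prop :=
  measurable_fun A f /\ (forall t, A t -> 0 <= f t) /\
  (\int[mu]_(t in A) ((`|f t| `^ p)%R%:E) < +oo)%E.

(* representatives of elements of L_oo^+ A *)
Definition Linf_plus (A : set R) (f : R -> R) : Prop :=
  measurable_fun A f /\ (forall t, A t -> 0 <= f t) /\
  (esssup_on A (fun t => `|f t|%R) < +oo)%E.

Definition dp (p : R) (A : set R) (f g : R -> R) : \bar R :=
  \int[mu]_(t in A) ((Num.max (f t) (g t) - Num.min (f t) (g t)) `^ p)%:E.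

(* a.e. equality on A (equality in L_p A) *)
Definition ae_eq_on (A : set R) (f g : R -> R) : Prop :=
  {ae mu, forall t, A t -> f t = g t}.

(* the semi-affine Read-Bajractarevic operator; linv i is l_i^{-1} *)
Definition RB_op (x : nat -> R) (n : nat) (linv q S : nat -> R -> R)
    (g : R -> R) : R -> R :=
  fun t => \sum_(1 <= i < n.+1) q i (linv i t) * \1_(Isub x n i) t
         + \sum_(1 <= i < n.+1) S i (linv i t) * g (linv i t) * \1_(Isub x n i) t.

Definition graph_on (A : set R) (f : R -> R) : set (R * R) :=
  [set u | A u.1 /\ u.2 = f u.1].

Definition hutchinson (n : nat) (l q S : nat -> R -> R) (G : set (R * R)) :
    set (R * R) :=
  \bigcup_(i in [set i : nat | (1 <= i <= n)%N])
     ((fun u : R * R => (l i u.1, q i u.1 + S i u.1 * u.2)) @` G).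

End Defs.

(* Main.v *)
(** The substitution s = l_i(t) gives, for measurable F >= 0,
    int_{I_i} F(l_i^-1(s)) ds <= int_I F(t) Dl_i(t) dt, so that
    int_I |Tf - Tg|^p <= sum_i int_I (Dl_i S_i^p) |f - g|^p <= c d_p(f, g) with
    c = sum_i ||Dl_i S_i^p||_oo < 1.  As Dl_i need not be continuous, the substitution rests on
    the fundamental theorem of calculus for Lipschitz functions, which follows from dominated
    convergence applied to difference quotients.

    Completeness of L_p is not needed: T is monotone, so the iterates T^k 0 increase pointwise,
    and since (u + v)^p <= A u^p + B v^p with B c < 1 their L_p norms stay bounded.  By monotone
    convergence the limit h is a.e. finite and in L_p, and wherever the iterates converge at t,
    h(l_i(t)) = q_i(t) + S_i(t) h(t).  Changing q_i and S_i on the remaining null set of t makes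
    this hold for all t, which says that the graph of h is the union of its images by the w_i. *)

Require Import Defs.
From HB Require Import structures.
From mathcomp Require Import all_boot all_order all_algebra.
From mathcomp Require Import all_classical all_reals all_analysis.
From mathcomp Require Import measurable_realfun ess_sup_inf ring lra.
Import Order.TTheory GRing.Theory Num.Theory.
Import numFieldNormedType.Exports.
Local Open Scope classical_set_scope.
Local Open Scope ring_scope.

Section lebesgue_ae.
Context {R : realType}.
Local Notation mu := (@lebesgue_measure R).

Lemma lebesgue_ae_mono (P Q : R -> Prop) : (forall t, P t -> Q t) ->
  {ae mu, forall t, P t} -> {ae mu, forall t, Q t}.
Proof. by move=> PQ; apply: negligibleS => t /= /(contra_not (PQ t)). Qed.

Lemma lebesgue_ae_and (P Q : R -> Prop) : {ae mu, forall t, P t} ->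
  {ae mu, forall t, Q t} -> {ae mu, forall t, P t /\ Q t}.
Proof.
move=> aeP aeQ; have := negligibleU aeP aeQ.
by apply: negligibleS => t /= /not_andP.
Qed.

End lebesgue_ae.

(** * The fundamental theorem of calculus for Lipschitz functions *)

Lemma is_derive_cvg_harmonic {R : realType} (f : R -> R) (t d : R) :
  is_derive t 1 f d ->
  (fun k : nat => k.+1%:R * (f (t + k.+1%:R^-1) - f t)) @ \oo --> d.
Proof.
move=> [df dE]; move: dE df; rewrite /derivable /derive => <- df.
have /cvgr_dnbhsP/(_ (fun k : nat => k.+1%:R^-1)) df' := df.
have {}df' := df' (conj _ cvg_harmonic).
rewrite (_ : (fun k : nat => _) = (fun n : nat => (n.+1%:R^-1)^-1 *:
    (f (n.+1%:R^-1 *: 1 + t) - f t))); last first.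
  by apply/funext => k; rewrite /= invrK [_%:A]mulr1 [_ + t]addrC.
by apply: df' => k; rewrite invr_eq0 pnatr_eq0.
Qed.

Lemma lipschitz_continuous {R : realType} (L : R -> R) (M : R) :
  (forall t u, `|L t - L u| <= M * `|t - u|) -> continuous L.
Proof.
move=> LM t; apply/cvgrPdist_le => e e0.
(* [M] may vanish, so a positive constant above it is taken in order to divide by it. *)
have M0 : 0 < `|M| + 1 by rewrite ltr_wpDl.
near=> u.
rewrite (le_trans (LM t u))// (le_trans (ler_wpM2r _ (_ : M <= `|M| + 1)))//.
  by rewrite (le_trans (ler_norm M))// lerDl.
rewrite -ler_pdivlMl//; near: u.
by apply: cvgr_dist_le; [exact: cvg_id|rewrite mulr_gt0// invr_gt0].
Unshelve. all: by end_near. Qed.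

Section lipschitz_ftc.
Context {R : realType} (L D : R -> R) (M : R).
Local Notation mu := (@lebesgue_measure R).
Hypothesis LM : forall t u, `|L t - L u| <= M * `|t - u|.

Let cL : continuous L. Proof. exact: lipschitz_continuous LM. Qed.

Let cDQ k h : continuous (fun t => k * (L (t + h) - L t)).
Proof.
have cLh : continuous (fun t => L (t + h)).
  apply: (@lipschitz_continuous _ _ M) => t u.
  by rewrite (le_trans (LM _ _))// opprD addrACA subrr addr0.
move=> t; apply: cvgM; first exact: cvg_cst.
by apply: cvgB; [exact: cLh|exact: cL].
Qed.

(** The integrand is continuous with antiderivative [k * (G (t + h) - G t)], so the classical
    theorem applies. When [k * h = 1] the result is a difference of two difference quotients of [G],
    at [b] and at [a], which tend to [L b] and [L a]. *)
Lemma integral_difference_quotient (G : R -> R) (a b k h : R) : a < b ->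
  0 <= h -> (forall t, a <= t <= b + h -> is_derive t 1 G (L t)) ->
  (\int[mu]_(t in `[a, b]) (k * (L (t + h) - L t))%:E =
   (k * (G (b + h) - G b) - k * (G (a + h) - G a))%:E)%E.
Proof.
move=> ab h0 dG.
have dF t : a <= t <= b ->
    is_derive t 1 (fun t => k * (G (t + h) - G t)) (k * (L (t + h) - L t)).
  move=> /andP[a_t tb].
  have G1 : is_derive (t + h) 1 G (L (t + h)) by apply: dG; lra.
  have G2 : is_derive t 1 G (L t) by apply: dG; lra.
  have G3 : is_derive t 1 (fun t => t + h) (1 + 0).
    exact: is_deriveD.
  have G4 := @is_derive1_comp _ G (fun t => t + h) t _ _ G1 G3.
  have G5 := is_deriveB G4 G2.
  by have := is_deriveZ k G5; rewrite addr0 mulr1.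
have cF t : a <= t <= b -> {for t, continuous (fun t => k * (G (t + h) - G t))}.
  move=> tab; apply/differentiable_continuous/derivable1_diffP.
  by have [] := dF _ tab.
rewrite (@continuous_FTC2 _ _ (fun t => k * (G (t + h) - G t)) a b)//.
- exact/continuous_subspaceT/cDQ.
- split.
  + move=> t; rewrite in_itv/= => /andP[t1 t2].
    by have /dF[] : a <= t <= b by lra.
  + by apply: cvg_at_right_filter; apply: cF; lra.
  + by apply: cvg_at_left_filter; apply: cF; lra.
- move=> t; rewrite in_itv/= => /andP[t1 t2].
  by rewrite derive1E; have /dF[] : a <= t <= b by lra.
Qed.

Lemma lipschitz_primitive (a b : R) : a < b -> exists G : R -> R,
  forall t, a < t < b -> is_derive t 1 G (L t).
Proof.
move=> ab; exists (fun x => \int[mu]_(t in `[a, x]) L t)%R => t /andP[a_t tb].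
have [||] := @continuous_FTC1_closed _ L a t b tb _ a_t.
- apply: continuous_compact_integrable; first exact: segment_compact.
  exact: continuous_subspaceT.
- exact: cL.
by move=> dG; rewrite derive1E => GE; split.
Qed.

(* The difference quotients k (L (t + 1/k) - L t) converge a.e. to [D] and are bounded by
   [M], so their integrals converge; these are difference quotients of a primitive of [L]. *)
Lemma lipschitz_FTC (a b : R) : a < b ->
  measurable_fun [set: R] D -> {ae mu, forall t : R, is_derive t 1 L (D t)} ->
  (\int[mu]_(t in `[a, b]) (D t)%:E = (L b - L a)%:E)%E.
Proof.
move=> ab mD dL.
(* The margins keep all points up to [b + 1], reached by the shifts of size at most 1, inside the
   open interval where [G] is differentiable. *)
have [|G dG] := @lipschitz_primitive (a - 1) (b + 2); first lra.
pose f_ (k : nat) (t : R) := (k.+1%:R * (L (t + k.+1%:R^-1) - L t))%:E.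
have f_int k : (\int[mu]_(t in `[a, b]) f_ k t =
    (k.+1%:R * (G (b + k.+1%:R^-1) - G b) - k.+1%:R * (G (a + k.+1%:R^-1) - G a))%:E)%E.
  have k0 : 0 <= k.+1%:R^-1 :> R by rewrite invr_ge0.
  have k1 : k.+1%:R^-1 <= 1 :> R by rewrite invf_le1 ?ler1n.
  have bnd h t : h <= 1 -> a <= t <= b + h -> a - 1 < t < b + 2 by move=> ? ?; lra.
  by apply: integral_difference_quotient => // t /(bnd _ _ k1)/dG.
have cvg1 : (fun k => \int[mu]_(t in `[a, b]) f_ k t)%E @ \oo --> (L b - L a)%:E.
  under eq_fun do rewrite f_int.
  apply: cvg_EFin; first by apply: nearW.
  by apply: cvgB; apply: is_derive_cvg_harmonic; apply: dG; lra.
have mf k : measurable_fun (`[a, b] : set R) (f_ k).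
  apply/measurable_EFinP/measurable_funTS.
  exact: (continuous_measurable_fun (@cDQ k.+1%:R k.+1%:R^-1)).
have f_D : {ae mu, forall t, `[a, b]%classic t -> f_ ^~ t @ \oo --> (D t)%:E}.
  apply: lebesgue_ae_mono dL => t dLt _.
  by apply: cvg_EFin; [exact: nearW|exact: is_derive_cvg_harmonic].
have f_M : {ae mu, forall t k, `[a, b]%classic t -> (`|f_ k t| <= M%:E)%E}.
  apply: aeW => t k _ /=; rewrite lee_fin normrM ger0_norm//.
  rewrite -ler_pdivlMl// (le_trans (LM _ _))// addrAC subrr add0r.
  by rewrite ger0_norm ?invr_ge0// mulrC.
have iM : mu.-integrable `[a, b] (cst M%:E).
  apply: (@continuous_compact_integrable _ (cst M)); first exact: segment_compact.
  by move=> ?; exact: cvg_cst.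
have mDab : measurable_fun (`[a, b] : set R) (EFin \o D).
  exact/measurable_EFinP/measurable_funTS.
have [_ _ cvg2] := @dominated_convergence _ _ _ mu `[a, b]%classic (measurable_itv _)
  f_ (EFin \o D) (cst M%:E) mf mDab f_D iM f_M.
by rewrite -(cvg_lim _ cvg1)// -(cvg_lim _ cvg2).
Qed.

End lipschitz_ftc.

(** * Change of variables *)

(** The proofs [mf] and [f0] are arguments so that the measure structure declared below can be
    inferred from the term. *)
Definition density_measure {d} {T : measurableType d} {R : realType}
    (mu : {measure set T -> \bar R}) {f : T -> R}
    (mf : measurable_fun [set: T] f) (f0 : forall x, 0 <= f x) : set T -> \bar R :=
  fun A => (\int[mu]_(x in A) (f x)%:E)%E.

Section density_measure.
Local Open Scope ereal_scope.
Context {d} {T : measurableType d} {R : realType} (mu : {measure set T -> \bar R}).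
Context {f : T -> R} (mf : measurable_fun [set: T] f) (f0 : forall x, (0 <= f x)%R).
Local Notation nu := (density_measure mu mf f0).

Let mEf : measurable_fun [set: T] (fun x => (f x)%:E). Proof. exact/measurable_EFinP. Qed.

Let Ef0 x : 0 <= (f x)%:E. Proof. by rewrite lee_fin. Qed.

Let nu0 : nu set0 = 0. Proof. exact: integral_set0. Qed.

Let nu_ge0 A : 0 <= nu A. Proof. by apply: integral_ge0 => x _. Qed.

Let nu_sigma_additive : semi_sigma_additive nu.
Proof. exact: semi_sigma_additive_nng_induced. Qed.

HB.instance Definition _ := isMeasure.Build _ _ _ nu nu0 nu_ge0 nu_sigma_additive.

Import HBNNSimple.

(** Both sides split into finite sums over the level sets of [h], where the claim is the definition
    of the density measure. *)
Lemma integral_density_nnsfun (h : {nnsfun T >-> R}) :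
  \int[nu]_x (h x)%:E = \int[mu]_x ((h x)%:E * (f x)%:E).
Proof.
have mh r : measurable (h @^-1` [set r]) by [].
rewrite integralT_nnsfun sintegralE.
transitivity (\int[mu]_x \sum_(r \in range h) (r * \1_(h @^-1` [set r]) x)%:E * (f x)%:E).
  rewrite ge0_integral_fsum//.
  - apply: eq_fsbigr => r /[1!inE] -[x _ <-].
    rewrite /density_measure -ge0_integralZl//; last 2 first.
    + exact: measurable_funTS.
    + by rewrite lee_fin.
    rewrite integral_mkcond; apply: eq_integral => t _.
    by rewrite patchE indicE; case: (t \in _); rewrite ?mulr1 ?mulr0 ?mul0e.
  - move=> r; apply: emeasurable_funM => //.
    by apply/measurable_EFinP; exact: measurable_funM.
  - by move=> r x _; rewrite mule_ge0// nnfun_muleindic_ge0.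
apply: eq_integral => x _.
by rewrite -ge0_mule_fsuml => [|y]; rewrite ?nnfun_muleindic_ge0// fsumEFin// -fimfunE.
Qed.

(** Simple functions increasing to [g] reduce this to [integral_density_nnsfun], by monotone
    convergence on both sides. *)
Lemma ge0_integral_density (g : T -> \bar R) : measurable_fun [set: T] g ->
  (forall x, 0 <= g x) -> \int[nu]_x g x = \int[mu]_x (g x * (f x)%:E).
Proof.
move=> mg g0; pose h := nnsfun_approx measurableT mg.
have hg x : EFin \o h ^~ x @ \oo --> g x by exact: cvg_nnsfun_approx.
have mh n : measurable_fun [set: T] (EFin \o h n).
  exact/measurable_EFinP.
have hnd x : {homo (fun n => (h n x)%:E) : m n / (m <= n)%N >-> m <= n}.
  by move=> m n mn; rewrite lee_fin; exact/lefP/nd_nnsfun_approx.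
have hfnd x : {homo (fun n => (h n x)%:E * (f x)%:E) : m n / (m <= n)%N >-> m <= n}.
  by move=> m n /(hnd x) mn; exact: lee_wpmul2r.
have hf x : (h n x)%:E * (f x)%:E @[n --> \oo] --> g x * (f x)%:E.
  by apply: cvgeZr => //; exact: hg.
transitivity (limn (fun n => \int[nu]_x (h n x)%:E)).
  rewrite -monotone_convergence//; last by move=> n x _; rewrite lee_fin.
  by apply: eq_integral => x _; apply/esym/cvg_lim => //; exact: hg.
transitivity (limn (fun n => \int[mu]_x ((h n x)%:E * (f x)%:E))).
  by congr (limn _); apply/funext => n; rewrite integral_density_nnsfun.
rewrite -monotone_convergence//.
- by apply: eq_integral => x _; apply/cvg_lim => //; exact: hf.
- by move=> n; apply: emeasurable_funM => //; exact: mh.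
- by move=> n x _; rewrite mule_ge0// lee_fin.
Qed.

End density_measure.

(** * Substitution along a Lipschitz bijection of the line *)

Section lipschitz_substitution.
Context {R : realType} {L phi D : R -> R} {M : R}.
Local Notation mu := (@lebesgue_measure R).
Hypothesis LM : forall t u, `|L t - L u| <= M * `|t - u|.
Hypothesis mD : measurable_fun [set: R] D.
Hypothesis D0 : forall t, 0 <= D t.
Hypothesis dL : {ae mu, forall t : R, is_derive t 1 L (D t)}.
Hypothesis LK : cancel L phi.
Hypothesis phiK : cancel phi L.
Hypothesis mphi : measurable_fun [set: R] phi.

(** An increment of [L] is the integral of [D], which is nonnegative; injectivity makes the
    inequality strict. *)
Let L_homo : {homo L : t u / t < u}.
Proof.
move=> t u tu; rewrite lt_neqAle; apply/andP; split.
  by rewrite (can_eq LK) lt_eqF.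
rewrite -subr_ge0 -lee_fin -(lipschitz_FTC L D M LM t u tu mD dL).
by apply: integral_ge0 => v _; rewrite lee_fin.
Qed.

Let L_mono : {mono L : t u / t <= u}. Proof. exact: le_mono. Qed.

Let preimage_ocitv (a b : R) : phi @^-1` `]a, b]%classic = `]L a, L b]%classic.
Proof.
apply/funext => s; rewrite /preimage/= !in_itv/= -[in RHS](phiK s).
by rewrite (leW_mono L_mono) L_mono.
Qed.

(* Both sides are measures in [A]; they agree on the half-open intervals by the
   fundamental theorem of calculus for [L]. *)
Lemma lebesgue_preimage (A : set R) : measurable A ->
  mu (phi @^-1` A) = (\int[mu]_(t in A) (D t)%:E)%E.
Proof.
pose nu : {measure set (measurableTypeR R) -> \bar R} := density_measure mu mD D0.
pose im : {measure set (measurableTypeR R) -> \bar R} :=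
  pushforward mu (phi : _ -> measurableTypeR R).
have agree (B : set R) : ocitv B -> im mphi B = nu B.
  move=> [[a b] _ <-] /=; rewrite /im /nu /= /pushforward /density_measure.
  rewrite preimage_ocitv lebesgue_measure_itv/= lte_fin.
  have [ab|ba] := ltP a b; last first.
    by rewrite ltNge L_mono ba/= set_itv_ge ?integral_set0// bnd_simp -leNgt.
  rewrite (L_homo _ _ ab) -EFinB -(lipschitz_FTC L D M LM a b ab mD dL).
  by apply/esym/integral_itv_obnd_cbnd/measurable_EFinP/measurable_funTS.
(* Uniqueness of a measure given on half-open intervals requires an exhaustion by such intervals of
   finite measure. *)
pose I_ (k : nat) : set (measurableTypeR R) := `](- k%:R), k%:R]%classic.
have I_ocitv k : ocitv (I_ k) by exists (- k%:R, k%:R).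
have I_cover : \bigcup_k I_ k = setT by exact: bigcup_itvT.
have I_fin k : (im mphi (I_ k) < +oo)%E.
  rewrite /im/= /pushforward preimage_ocitv lebesgue_measure_itv/=.
  by case: ifP => _; rewrite ?ltry// -EFinB ltry.
exact: (@measure_unique _ _ (measurableTypeR R) (@ocitv R) I_ erefl (@ocitvI R)
  I_ocitv I_cover (im mphi) nu agree I_fin A).
Qed.

(** The preimage under [phi] is the image under [L], and its measure is an integral of [D] over a
    null set. *)
Lemma negligible_preimage (N : set R) : mu.-negligible N -> mu.-negligible (phi @^-1` N).
Proof.
move=> [A [mA A0 NA]]; exists (phi @^-1` A); split.
- by rewrite -[X in measurable X]setTI; exact: mphi.
- rewrite lebesgue_preimage//; apply: null_set_integral => //.
  exact/measurable_EFinP/measurable_funTS.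
- by move=> s /NA.
Qed.

(** By [lebesgue_preimage], the pushforward of Lebesgue measure by [phi] is the measure with density
    [D]. *)
Lemma integral_lipschitz_substitution (F : R -> \bar R) :
  measurable_fun [set: R] F -> (forall t, 0 <= F t)%E ->
  (\int[mu]_s F (phi s) = \int[mu]_t (F t * (D t)%:E))%E.
Proof.
move=> mF F0.
rewrite -(ge0_integral_density mu mD D0)//.
transitivity (\int[pushforward mu (phi : _ -> measurableTypeR R)]_s F s)%E.
  by rewrite ge0_integral_pushforward// preimage_setT.
by apply: eq_measure_integral => A mA _; exact: lebesgue_preimage.
Qed.

End lipschitz_substitution.

(** For [a <= b], the nearest-point projection onto the interval. *)
Definition clamp {R : realType} (a b t : R) : R := Num.max a (Num.min t b).

Lemma clamp_cases {R : realType} (a b t : R) : a <= b ->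
  [\/ t < a /\ clamp a b t = a, a <= t <= b /\ clamp a b t = t | b < t /\ clamp a b t = b].
Proof.
move=> ab; rewrite /clamp; have [ta|a_t] := ltrP t a.
  by apply: Or31; split => //; apply: max_l; rewrite ge_min (ltW ta).
have [bt|tb] := ltrP b t.
  by apply: Or33; split => //; rewrite max_r// le_min ltW.
by apply: Or32; split => //; rewrite max_r.
Qed.

Lemma cIE {R : realType} (a b : R) : cI a b = `[a, b]%classic.
Proof. by apply/seteqP; split => t; rewrite /cI/= in_itv. Qed.

Lemma measurable_cI {R : realType} (a b : R) : measurable (cI a b).
Proof. by rewrite cIE; exact: measurable_itv. Qed.

(** * Substitution between two compact intervals *)

Section local_substitution.
Context {R : realType} {a b c d C : R} {l linv Dl : R -> R}.
Local Notation mu := (@lebesgue_measure R).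
Hypotheses (ab : a < b) (cd : c < d).
Hypothesis l_J : forall t, cI a b t -> cI c d (l t).
Hypothesis linv_I : forall s, cI c d s -> cI a b (linv s).
Hypothesis lK : forall t, cI a b t -> linv (l t) = t.
Hypothesis linvK : forall s, cI c d s -> l (linv s) = s.
Hypotheses (l_a : l a = c) (l_b : l b = d).
Hypothesis lC : forall t u, cI a b t -> cI a b u -> `|l t - l u| <= C * `|t - u|.
Hypothesis mlinv : measurable_fun (cI c d) linv.
Hypothesis dl : forall t : R, a < t < b -> is_derive t 1 l (Dl t).
Hypothesis mDl : measurable_fun (cI a b) Dl.
Hypothesis Dl0 : forall t, cI a b t -> 0 <= Dl t.

(* [l] extended to a bijection of the line by translations. *)
Let L t := l (clamp a b t) + (t - clamp a b t).
Let phi s := linv (clamp c d s) + (s - clamp c d s).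
(** The value 1 is the derivative of the translations that extend [l]. *)
Let D t := if t \in cI a b then Dl t else 1.

Let linv_c : linv c = a. Proof. by rewrite -l_a lK// /cI/= lexx ltW. Qed.
Let linv_d : linv d = b. Proof. by rewrite -l_b lK// /cI/= lexx ltW. Qed.

Let L_in t : cI a b t -> L t = l t.
Proof.
by move=> abt; rewrite /L; have [[? ->]|[? ->]|[? ->]] := clamp_cases a b t (ltW ab);
  rewrite ?subrr ?addr0//; move: abt; rewrite /cI/= => ?; lra.
Qed.

Let phi_in s : cI c d s -> phi s = linv s.
Proof.
by move=> cds; rewrite /phi; have [[? ->]|[? ->]|[? ->]] := clamp_cases c d s (ltW cd);
  rewrite ?subrr ?addr0//; move: cds; rewrite /cI/= => ?; lra.
Qed.

Let LK : cancel L phi.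
Proof.
(* [lra] ignores section hypotheses. *)
have [ab' cd'] := (ab, cd).
move=> t; have [[ta E]|[abt _]|[bt E]] := clamp_cases a b t (ltW ab).
- rewrite /L E l_a /phi.
  have [[_ ->]|[? _]|[? _]] := clamp_cases c d (c + (t - a)) (ltW cd); [|lra|lra].
  by rewrite linv_c; lra.
- by rewrite (L_in t abt) phi_in ?lK//; exact: l_J.
- rewrite /L E l_b /phi.
  have [[? _]|[? _]|[_ ->]] := clamp_cases c d (d + (t - b)) (ltW cd); [lra|lra|].
  by rewrite linv_d; lra.
Qed.

Let phiK : cancel phi L.
Proof.
have [ab' cd'] := (ab, cd).
move=> s; have [[sc E]|[cds _]|[ds E]] := clamp_cases c d s (ltW cd).
- rewrite /phi E linv_c /L.
  have [[_ ->]|[? _]|[? _]] := clamp_cases a b (a + (s - c)) (ltW ab); [|lra|lra].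
  by rewrite l_a; lra.
- by rewrite (phi_in s cds) L_in ?linvK//; exact: linv_I.
- rewrite /phi E linv_d /L.
  have [[? _]|[? _]|[_ ->]] := clamp_cases a b (b + (s - d)) (ltW ab); [lra|lra|].
  by rewrite l_b; lra.
Qed.

Let clamp_I t : cI a b (clamp a b t).
Proof.
have ab' := ab.
by rewrite /cI/=; have [[? ->]|[? ->]|[? ->]] := clamp_cases a b t (ltW ab); lra.
Qed.

(** For [u <= t], both [clamp] and its complement increase by at most [t - u]; the first contributes
    |C| through [l], the second 1. *)
Let LM t u : `|L t - L u| <= (`|C| + 1) * `|t - u|.
Proof.
wlog tu : t u / u <= t.
  move=> H; have [tu|ut] := leP u t; first exact: H.
  by rewrite distrC [`|t - u|]distrC; apply: H; exact: ltW.
have ab' := ab.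
have [c1 c2] : 0 <= clamp a b t - clamp a b u <= t - u /\
    0 <= (t - clamp a b t) - (u - clamp a b u) <= t - u.
  have [[? ->]|[? ->]|[? ->]] := clamp_cases a b t (ltW ab);
  have [[? ->]|[? ->]|[? ->]] := clamp_cases a b u (ltW ab); split; lra.
rewrite /L opprD addrACA (le_trans (ler_normD _ _))// mulrDl mul1r.
rewrite [`|t - u|]ger0_norm ?subr_ge0//; apply: lerD; last first.
  by case/andP: c2 => ? ?; rewrite ger0_norm.
rewrite (le_trans (lC _ _ _ _))//; case/andP: c1 => c3 c4.
by rewrite ger0_norm// (le_trans (ler_wpM2r c3 (ler_norm C)))// ler_wpM2l.
Qed.

Let mphi : measurable_fun [set: R] phi.
Proof.
have mclamp : measurable_fun [set: R] (clamp c d).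
  by apply: measurable_maxr => //; exact: measurable_minr.
apply: measurable_funD; last exact: measurable_funB.
apply: (measurable_comp (measurable_cI c d)) => //.
have cd' := cd; move=> _ [s _ <-]; rewrite /cI/=.
by have [[? ->]|[? ->]|[? ->]] := clamp_cases c d s (ltW cd); lra.
Qed.

Let mD : measurable_fun [set: R] D.
Proof.
have mI := measurable_cI a b.
have preI : (fun t => t \in cI a b) @^-1` [set true] = cI a b.
  by apply/seteqP; split => t; [move/set_mem|move/mem_set].
apply: measurable_fun_if => //.
- by apply: (measurable_fun_bool true); rewrite preI setTI.
- by rewrite preI setTI.
Qed.

Let D0 t : 0 <= D t.
Proof. by rewrite /D; case: ifPn => // /[1!inE]; exact: Dl0. Qed.

(** Away from the two endpoints, a null set, [L] coincides near [t] with [l] or with a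
    translation. *)
Let dL : {ae mu, forall t : R, is_derive t 1 L (D t)}.
Proof.
have neg : mu.-negligible ([set a] `|` [set b]).
  by apply: negligibleU; apply/negligibleP => //; exact: lebesgue_measure_set1.
apply: negligibleS neg => t /= ndL; apply/not_notP => /not_orP[ta tb]; apply: ndL.
have ab' := ab.
have out (k : R) : is_derive t 1 (fun u => k + u) 1.
  have := is_deriveD (is_derive_cst k t 1) (is_derive_id t 1).
  by rewrite add0r.
have [t_lt_a|a_le_t] := ltrP t a.
  have -> : D t = 1.
    by rewrite /D; case: ifPn => // /[1!inE]; rewrite /cI/= => ?; lra.
  apply: near_eq_is_derive (out (c - a)).
  have := @near_in_itvNyo _ a t; rewrite in_itv/= t_lt_a => /(_ isT).
  apply: filterS => u; rewrite in_itv/= => ua; rewrite /L.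
  have [[_ ->]|[? _]|[? _]] := clamp_cases a b u (ltW ab); [|lra|lra].
  by rewrite l_a; lra.
have [b_lt_t|t_le_b] := ltrP b t.
  have -> : D t = 1.
    by rewrite /D; case: ifPn => // /[1!inE]; rewrite /cI/= => ?; lra.
  apply: near_eq_is_derive (out (d - b)).
  have := @near_in_itvoy _ b t; rewrite in_itv/= b_lt_t => /(_ isT).
  apply: filterS => u; rewrite in_itv/= andbT => bu; rewrite /L.
  have [[? _]|[? _]|[_ ->]] := clamp_cases a b u (ltW ab); [lra|lra|].
  by rewrite l_b; lra.
have atb : a < t < b.
  by rewrite !lt_neqAle a_le_t t_le_b !andbT; apply/andP; split;
    apply/eqP => H; [apply: ta|apply: tb].
have -> : D t = Dl t.
  by rewrite /D ifT// inE /cI/=; lra.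
apply: near_eq_is_derive (dl t atb).
have := @near_in_itvoo _ a b t; rewrite in_itv/= => /(_ atb).
by apply: filterS => u; rewrite in_itv/= => aub; rewrite L_in// /cI/=; lra.
Qed.

Lemma negligible_preimage_in (N : set R) : mu.-negligible N ->
  mu.-negligible [set s | cI c d s /\ N (linv s)].
Proof.
move=> /(negligible_preimage LM mD D0 dL LK phiK mphi).
by apply: negligibleS => s [cds]; rewrite /preimage/= phi_in.
Qed.

(** This is the formula on the line for [F] extended by zero, since [phi s] lies in [cI a b] exactly
    when [s] lies in [cI c d]. *)
Lemma integral_substitution_in (F : R -> \bar R) :
  measurable_fun (cI a b) F -> (forall t, cI a b t -> 0 <= F t)%E ->
  (\int[mu]_(s in cI c d) F (linv s) = \int[mu]_(t in cI a b) (F t * (Dl t)%:E))%E.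
Proof.
move=> mF F0.
have := integral_lipschitz_substitution LM mD D0 dL LK phiK mphi (F \_ (cI a b)).
have phi_I s : (phi s \in cI a b) = (s \in cI c d).
  apply/idP/idP => /[!inE] H; last by rewrite phi_in//; exact: linv_I.
  by rewrite -(phiK s) L_in//; exact: l_J.
move=> H; rewrite [LHS]integral_mkcond [RHS]integral_mkcond.
transitivity (\int[mu]_s (F \_ (cI a b)) (phi s))%E.
  apply: eq_integral => s _; rewrite !patchE phi_I; case: ifPn => // /[1!inE] cds.
  by rewrite phi_in.
rewrite H.
- apply: eq_integral => t _; rewrite /D [RHS]patchE patchE; case: ifPn => // _.
  exact: mul0e.
- by apply/(measurable_restrictT _ (measurable_cI a b)).
- by move=> t; rewrite patchE; case: ifPn => // /[1!inE]; exact: F0.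
Qed.

End local_substitution.

(** * Distances and real powers *)

Lemma max_sub_minE {R : realDomainType} (u v : R) : Num.max u v - Num.min u v = `|u - v|.
Proof.
by have [uv|vu] := leP u v; [rewrite distrC ger0_norm ?subr_ge0|rewrite ger0_norm ?subr_ge0 ?ltW].
Qed.

(** Either [u <= e * v], and [u + v] is at most [(1 + e) * v], or [v] is below [u / e], and it is at
    most [(1 + e^-1) * u]. *)
Lemma powRD_le {R : realType} (p e u v : R) : 0 <= p -> 0 < e -> 0 <= u -> 0 <= v ->
  (u + v) `^ p <= (1 + e^-1) `^ p * u `^ p + (1 + e) `^ p * v `^ p.
Proof.
move=> p0 e0 u0 v0; have e1 : 0 <= e^-1 by rewrite invr_ge0 ltW.
have [uev|evu] := leP u (e * v).
  rewrite (@le_trans _ _ ((1 + e) `^ p * v `^ p))//; last first.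
    by rewrite lerDr mulr_ge0 ?powR_ge0.
  rewrite -powRM ?addr_ge0 ?(ltW e0)//; apply: ge0_ler_powR => //; rewrite ?nnegrE.
  - exact: addr_ge0.
  - by rewrite mulr_ge0 ?addr_ge0 ?(ltW e0).
  - by rewrite mulrDl mul1r addrC lerD2l.
rewrite (@le_trans _ _ ((1 + e^-1) `^ p * u `^ p))//; last first.
  by rewrite lerDl mulr_ge0 ?powR_ge0.
rewrite -powRM ?addr_ge0//; apply: ge0_ler_powR => //; rewrite ?nnegrE.
- exact: addr_ge0.
- by rewrite mulr_ge0 ?addr_ge0.
- by rewrite mulrDl mul1r lerD2l -ler_pdivrMl ?invr_gt0// invrK ltW.
Qed.

Lemma powRD_le_contract {R : realType} (p c : R) : 0 < p -> 0 <= c < 1 ->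
  exists A B : R, [/\ 0 <= A, 0 <= B, B * c < 1 &
    forall u v, 0 <= u -> 0 <= v -> (u + v) `^ p <= A * u `^ p + B * v `^ p].
Proof.
move=> p0 /andP[c0 c1]; pose k : R := 2 / (c + 1).
have c10 : 0 < c + 1 by lra.
have k1 : 1 < k by rewrite /k ltr_pdivlMr//; lra.
pose t := k `^ p^-1.
have t1 : 1 < t.
  have : 1 `^ p^-1 < k `^ p^-1.
    by apply: gt0_ltr_powR; rewrite ?invr_gt0// ?nnegrE//; lra.
  by rewrite powR1.
have tp : t `^ p = k.
  by rewrite /t -powRrM mulVf ?gt_eqF// powRr1//; lra.
exists ((1 + (t - 1)^-1) `^ p), k; split.
- exact: powR_ge0.
- lra.
- by rewrite /k mulrAC ltr_pdivrMr//; lra.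
- move=> u v u0 v0; have := @powRD_le _ p (t - 1) u v (ltW p0).
  rewrite (_ : 1 + (t - 1) = t) ?tp; last lra.
  by apply => //; lra.
Qed.

(** * Essential supremum over a set *)

Section essential_supremum_on.
Context {R : realType} (A : set R) (h : R -> R).
Local Notation mu := (@lebesgue_measure R).

(** The infimum of the essential bounds is itself one: it is the essential supremum of [h] extended
    by [-oo] outside [A]. *)
Lemma esssup_on_le : {ae mu, forall t, A t -> ((h t)%:E <= esssup_on A h)%E}.
Proof.
pose g t : \bar R := if t \in A then (h t)%:E else -oo%E.
have -> : esssup_on A h = ess_sup mu g.
  congr (ereal_inf _); apply/seteqP; split => M /=;
    apply: lebesgue_ae_mono => t; rewrite /g.
    by case: ifPn => [/set_mem At /(_ At)//|_ _]; exact: leNye.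
  by move=> + At; rewrite ifT//; exact: mem_set.
have := ess_sup_ge mu g; apply: lebesgue_ae_mono => t + At.
by rewrite /g ifT//; exact: mem_set.
Qed.

(** A negative essential bound of a nonnegative function would make [A] null. On a null set every
    bound is admissible and the infimum is [-oo]. *)
Lemma esssup_on_ge0 : ~ mu.-negligible A -> (forall t, A t -> 0 <= h t) ->
  (0 <= esssup_on A h)%E.
Proof.
move=> A0 h0; apply: le_ereal_inf_tmp => M /= hM.
rewrite leNgt; apply/negP => M0; apply: A0.
apply: negligibleS hM => t At /= /(_ At) htM.
have := lt_le_trans (le_lt_trans htM M0) (h0 t At : (0 <= (h t)%:E)%E).
by rewrite ltxx.
Qed.

End essential_supremum_on.

(** * The partition of the interval *)

Section partition.
Context {R : realType} {n : nat} {x : nat -> R}.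
Local Notation mu := (@lebesgue_measure R).
Hypothesis x_incr : forall k, (k < n)%N -> x k < x k.+1.

Lemma nodes_le j k : (j <= k <= n)%N -> x j <= x k.
Proof.
move=> /andP[]; elim: k => [|k IH]; first by rewrite leqn0 => /eqP ->.
rewrite leq_eqVlt => /predU1P[->//|jk] kn.
by rewrite (le_trans (IH jk (ltnW kn)))// ltW// x_incr.
Qed.

Lemma node_lt i : (1 <= i <= n)%N -> x i.-1 < x i.
Proof. by case: i => // i /andP[_ ?]; exact: x_incr. Qed.

Lemma node_interval_sub i : (1 <= i <= n)%N -> cI (x i.-1) (x i) `<=` cI (x 0%N) (x n).
Proof.
move=> /andP[i1 i_n] t; rewrite /cI/= => /andP[t1 t2].
rewrite (le_trans _ t1) ?(le_trans t2)//; apply: nodes_le; first by rewrite i_n leqnn.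
by rewrite leq0n (leq_trans (leq_pred i)).
Qed.

Lemma Isub_sub i : Isub x n i `<=` cI (x i.-1) (x i).
Proof.
rewrite /Isub; case: ifP => _ t //= /andP[t1 t2].
by rewrite /cI/= t1/= ltW.
Qed.

Lemma measurable_Isub i : measurable (Isub x n i).
Proof.
rewrite /Isub; case: ifP => _; last exact: measurable_cI.
by rewrite (_ : mkset _ = `[x i.-1, x i[%classic)//; apply/seteqP; split => t /=; rewrite in_itv.
Qed.

(** If [i < j], piece [i] is open on the right, so its points lie strictly below [x i], hence below
    [x j.-1]. *)
Lemma Isub_inj i j t : (1 <= i <= n)%N -> (1 <= j <= n)%N -> Isub x n i t -> Isub x n j t -> i = j.
Proof.
wlog ij : i j / (i <= j)%N.
  by move=> H i1 j1 it jt; have [ij|/ltnW ji] := leqP i j; [|symmetry]; apply: H.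
move=> /andP[i1 i_n] /andP[j1 jn]; move: ij; rewrite leq_eqVlt => /predU1P[//|ij].
rewrite {1}/Isub (leq_trans ij jn)/= => /andP[_ txi] /Isub_sub/andP[xjt _].
have : x i <= x j.-1 by apply: nodes_le; rewrite -ltnS prednK// ij (leq_trans (leq_pred j)).
by rewrite leNgt (le_lt_trans xjt txi).
Qed.

Lemma Isub_cover t : (0 < n)%N -> cI (x 0%N) (x n) t -> exists2 i, (1 <= i <= n)%N & Isub x n i t.
Proof.
move=> n0 /andP[x0t txn].
(* The least such index is that of the piece containing [t]. The disjunct [n <= i] sends [t = x n]
   to the last piece, which is closed. *)
have ex : exists i, (n <= i)%N || (t < x i) by exists n; rewrite leqnn.
case: (ex_minnP ex) => -[|i] Pi mini.
  by move: Pi; rewrite leqn0 (gtn_eqF n0)/= ltNge x0t.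
have i_n : (i < n)%N.
  by apply: mini; rewrite leqnn.
have xit : x i <= t.
  by rewrite leNgt; apply/negP => txi; have := mini i; rewrite txi orbT ltnn => /(_ isT).
exists i.+1 => //; rewrite /Isub; case: ltnP => [i1n|_].
  by move: Pi; rewrite leqNgt i1n/= => ->; rewrite xit.
rewrite /cI/= xit /=.
move: Pi => /orP[ni|/ltW//]; suff -> : i.+1 = n by [].
by apply/eqP; rewrite eqn_leq i_n ni.
Qed.

Lemma partition_bigcup : (0 < n)%N ->
  cI (x 0%N) (x n) = \bigcup_(i in [set i | (1 <= i <= n)%N]) Isub x n i.
Proof.
move=> n0; apply/seteqP; split => t; first by move=> /(Isub_cover t n0)[i i1 it]; exists i.
by move=> [i /= i1 /Isub_sub]; exact: node_interval_sub.
Qed.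

Lemma partition_bigsetU : (0 < n)%N ->
  cI (x 0%N) (x n) = \big[setU/set0]_(1 <= i < n.+1) Isub x n i.
Proof.
move=> n0; rewrite partition_bigcup// -bigcup_seq; apply: eq_bigcupl.
by split => i /=; rewrite mem_index_iota ltnS.
Qed.

Lemma integral_partition (h : R -> \bar R) : (0 < n)%N ->
  measurable_fun (cI (x 0%N) (x n)) h -> (forall t, cI (x 0%N) (x n) t -> 0 <= h t)%E ->
  (\int[mu]_(t in cI (x 0%N) (x n)) h t =
   \sum_(1 <= i < n.+1) \int[mu]_(t in Isub x n i) h t)%E.
Proof.
move=> n0; rewrite partition_bigsetU// => mh h0.
apply: ge0_integral_bigsetU => //; first exact: measurable_Isub.
  exact: iota_uniq.
move=> i j /=; rewrite !mem_index_iota !ltnS => i1 j1 [t [it jt]].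
exact: Isub_inj it jt.
Qed.

Lemma measurable_fun_partition d (T : measurableType d) (h : R -> T) : (0 < n)%N ->
  (forall i, (1 <= i <= n)%N -> measurable_fun (Isub x n i) h) ->
  measurable_fun (cI (x 0%N) (x n)) h.
Proof.
move=> n0 mh; rewrite partition_bigcup// bigcup_mkcond; apply/measurable_fun_bigcup.
  by move=> i; case: ifP => // _; exact: measurable_Isub.
move=> i; case: ifPn => [/set_mem|_]; first exact: mh.
exact: measurable_fun_set0.
Qed.

End partition.

(** * The Read-Bajraktarevic operator *)

Section read_bajraktarevic.
Context {R : realType} {n : nat} {x : nat -> R} {p : R} {l linv Dl q S : nat -> R -> R}.
Local Notation mu := (@lebesgue_measure R).
Local Notation I := (cI (x 0%N) (x n)).
Local Notation T := (RB_op x n linv q S).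
Local Notation piece i := (Isub x n i).
Hypothesis n0 : (0 < n)%N.
Hypothesis x_incr : forall k, (k < n)%N -> x k < x k.+1.
Hypothesis p1 : 1 <= p.
Hypothesis homeo : forall i, (1 <= i <= n)%N ->
  {within I, continuous (l i : R -> R)} /\
  {within cI (x i.-1) (x i), continuous (linv i : R -> R)} /\
  (forall t, I t -> cI (x i.-1) (x i) (l i t)) /\
  (forall s, cI (x i.-1) (x i) s -> I (linv i s)) /\
  (forall t, I t -> linv i (l i t) = t) /\
  (forall s, cI (x i.-1) (x i) s -> l i (linv i s) = s).
Hypothesis contr : forall i, (1 <= i <= n)%N -> exists c : R, c < 1 /\
  forall t u, I t -> I u -> `|l i t - l i u| <= c * `|t - u|.
Hypothesis l_end : forall i, (1 <= i <= n)%N -> l i (x 0%N) = x i.-1 /\ l i (x n) = x i.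
Hypothesis deriv : forall i, (1 <= i <= n)%N ->
  (forall t, x 0%N < t < x n -> is_derive t 1 (l i) (Dl i t)) /\ Linf_plus I (Dl i).
Hypothesis q_Lp : forall i, (1 <= i <= n)%N -> Lp_plus p I (q i).
Hypothesis S_Linf : forall i, (1 <= i <= n)%N -> Linf_plus I (S i).

Let p0 : 0 < p. Proof. exact: lt_le_trans p1. Qed.

Lemma nodes_lt : x 0%N < x n.
Proof.
rewrite (lt_le_trans (x_incr _ n0))//; apply: (nodes_le x_incr).
by rewrite n0 leqnn.
Qed.

Lemma measurable_linv i : (1 <= i <= n)%N -> measurable_fun (cI (x i.-1) (x i)) (linv i).
Proof.
move=> /homeo[_ [clinv _]]; apply: subspace_continuous_measurable_fun => //.
exact: measurable_cI.
Qed.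

Lemma piece_I i t : (1 <= i <= n)%N -> piece i t -> I t.
Proof. by move=> i1 /Isub_sub; exact: (node_interval_sub x_incr). Qed.

Lemma linv_in i s : (1 <= i <= n)%N -> piece i s -> I (linv i s).
Proof. by move=> i1 /Isub_sub; have [_ [_ [_ [+ _]]]] := homeo i i1; apply. Qed.

Lemma measurable_comp_linv d (U : measurableType d) (h : R -> U) i :
  (1 <= i <= n)%N -> measurable_fun I h -> measurable_fun (piece i) (h \o linv i).
Proof.
move=> i1 mh; apply: (measurable_comp (measurable_cI _ _) _ mh).
  by move=> _ [s ps <-]; exact: linv_in.
apply: measurable_funS (measurable_linv i i1); first exact: measurable_cI.
exact: Isub_sub.
Qed.

(** The substitution is an equality on the closed interval that contains the piece; monotonicity of
    the integral gives the rest. *)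
Lemma integral_piece_le i (F : R -> \bar R) : (1 <= i <= n)%N ->
  measurable_fun I F -> (forall t, I t -> 0 <= F t)%E ->
  (\int[mu]_(s in piece i) F (linv i s) <= \int[mu]_(t in I) (F t * (Dl i t)%:E))%E.
Proof.
move=> i1 mF F0; have [_ [_ [l_J [linv_I [lK linvK]]]]] := homeo i i1.
have [C [_ lC]] := contr i i1; have [l_a l_b] := l_end i i1.
have [dl [mDl [Dl0 _]]] := deriv i i1.
rewrite -(integral_substitution_in nodes_lt (node_lt x_incr i i1) l_J linv_I lK linvK
  l_a l_b lC (measurable_linv i i1) dl mDl Dl0 F mF F0).
apply: ge0_subset_integral.
- exact: measurable_Isub.
- exact: measurable_cI.
- apply: (measurable_comp (measurable_cI _ _) _ mF); last exact: measurable_linv.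
  by move=> _ [s ps <-]; exact: linv_I.
- by move=> s /linv_I; exact: F0.
- exact: Isub_sub.
Qed.

Lemma negligible_comp_linv i (N : set R) : (1 <= i <= n)%N -> mu.-negligible N ->
  mu.-negligible [set s | piece i s /\ N (linv i s)].
Proof.
move=> i1 N0; have [_ [_ [l_J [linv_I [lK linvK]]]]] := homeo i i1.
have [C [_ lC]] := contr i i1; have [l_a l_b] := l_end i i1.
have [dl [mDl [Dl0 _]]] := deriv i i1.
have := negligible_preimage_in nodes_lt (node_lt x_incr i i1) l_J linv_I lK linvK
  l_a l_b lC (measurable_linv i i1) dl mDl Dl0 N N0.
by apply: negligibleS => s [/Isub_sub].
Qed.

Lemma RB_opE i g t : (1 <= i <= n)%N -> piece i t ->
  T g t = q i (linv i t) + S i (linv i t) * g (linv i t).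
Proof.
move=> i1 it.
(* The pieces are disjoint, so one term survives in each sum. *)
have pick (F : nat -> R) : \sum_(1 <= j < n.+1) F j * \1_(piece j) t = F i.
  rewrite (bigD1_seq i) ?mem_index_iota ?iota_uniq//= indicE mem_set// mulr1.
  rewrite big_seq_cond big1 ?addr0// => j /andP[]; rewrite mem_index_iota ltnS => j1 ji.
  rewrite indicE memNset ?mulr0// => jt.
  by move/eqP: ji; apply; exact: (Isub_inj x_incr j i t).
by rewrite /RB_op !pick.
Qed.

Lemma measurable_RB_op g : measurable_fun I g -> measurable_fun I (T g).
Proof.
move=> mg; apply: (measurable_fun_partition) => // i i1.
apply: (eq_measurable_fun (fun t => q i (linv i t) + S i (linv i t) * g (linv i t))).
  by move=> t /set_mem it; rewrite (RB_opE i).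
apply: measurable_funD; first by apply: measurable_comp_linv => //; have [] := q_Lp i i1.
apply: measurable_funM; last exact: measurable_comp_linv.
by apply: measurable_comp_linv => //; have [] := S_Linf i i1.
Qed.

Lemma RB_op_ge0 (g : R -> R) : (forall t, I t -> 0 <= g t) -> forall t, I t -> 0 <= T g t.
Proof.
move=> g0 t /(Isub_cover t n0)[i i1 it]; rewrite (RB_opE i)//.
have It := linv_in i t i1 it.
have [_ [q0 _]] := q_Lp i i1; have [_ [S0 _]] := S_Linf i i1.
by rewrite addr_ge0 ?q0// mulr_ge0 ?S0// g0.
Qed.

Lemma RB_op_le (f g : R -> R) : (forall t, I t -> f t <= g t) -> forall t, I t -> T f t <= T g t.
Proof.
move=> fg t /(Isub_cover t n0)[i i1 it]; rewrite !(RB_opE i)//.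
have It := linv_in i t i1 it; have [_ [S0 _]] := S_Linf i i1.
by rewrite lerD2l ler_wpM2l ?S0// fg.
Qed.

(** * The contraction constant and the integral estimates *)

Let norm_ i : \bar R := esssup_on I (fun t => `|Dl i t * S i t `^ p|%R).
Hypothesis small : (\sum_(1 <= i < n.+1) norm_ i < 1)%E.
Let c : R := fine (\sum_(1 <= i < n.+1) norm_ i)%E.

Let I_nonnegligible : ~ mu.-negligible I.
Proof.
move=> I_null; have : mu I = 0 by apply: measure_negligible; [exact: measurable_cI|].
rewrite cIE; have := lebesgue_measure_itv `[x 0%N, x n]; rewrite /= lte_fin nodes_lt => ->.
by move/eqP; rewrite -EFinB eqe subr_eq0 gt_eqF// nodes_lt.
Qed.

Let norm_ge0 i : (0 <= norm_ i)%E.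
Proof. by apply: esssup_on_ge0 => // t _; exact: normr_ge0. Qed.

Let sum_normE : (\sum_(1 <= i < n.+1) norm_ i = c%:E)%E.
Proof.
rewrite /c fineK// ge0_fin_numE ?(lt_trans small) ?ltry//.
by apply: sume_ge0 => i _; exact: norm_ge0.
Qed.

Lemma contraction_bound : 0 <= c < 1.
Proof.
rewrite -lte_fin -lee_fin -sum_normE small andbT.
by apply: sume_ge0 => i _; exact: norm_ge0.
Qed.

Lemma measurable_EFin_powR (h : R -> R) (D : set R) : measurable_fun D h ->
  measurable_fun D (fun t => (h t `^ p)%:E).
Proof. by move=> mh; apply/measurable_EFinP/(measurableT_comp (measurable_powR p)). Qed.

(** After substitution the weight in front of [h t]^ p[is]Dl i t * S i t [^ p], bounded almost
    everywhere by [norm_ i]. *)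
Lemma integral_piece_S i (h : R -> R) : (1 <= i <= n)%N -> measurable_fun I h ->
  (forall t, I t -> 0 <= h t) ->
  (\int[mu]_(s in piece i) ((S i (linv i s) * h (linv i s)) `^ p)%:E <=
   norm_ i * \int[mu]_(t in I) (h t `^ p)%:E)%E.
Proof.
move=> i1 mh h0; have [mS [S0 _]] := S_Linf i i1; have [_ [mDl [Dl0 _]]] := deriv i i1.
have mSh : measurable_fun I (fun t => ((S i t * h t) `^ p)%:E).
  by apply: measurable_EFin_powR; exact: measurable_funM.
have := integral_piece_le i (fun t => ((S i t * h t) `^ p)%:E) i1 mSh.
move=> /(_ (fun t _ => powR_ge0 _ _)) /le_trans; apply.
rewrite -ge0_integralZl//; last 3 first.
- exact: measurable_cI.
- exact: measurable_EFin_powR.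
- by move=> t _; rewrite lee_fin powR_ge0.
apply: ae_ge0_le_integral.
- exact: measurable_cI.
- by move=> t It; rewrite -EFinM lee_fin mulr_ge0 ?powR_ge0 ?Dl0.
- by apply: emeasurable_funM => //; exact/measurable_EFinP.
- by move=> t It; rewrite mule_ge0// lee_fin powR_ge0.
- by apply: emeasurable_funM => //; exact: measurable_EFin_powR.
have := esssup_on_le I (fun t => `|Dl i t * S i t `^ p|).
apply: lebesgue_ae_mono => t /[swap] It /(_ It) norm_t.
rewrite powRM ?S0 ?h0// -EFinM mulrAC [_ * Dl i t]mulrC EFinM.
apply: lee_wpmul2r; first by rewrite lee_fin powR_ge0.
by apply: le_trans norm_t; rewrite lee_fin ler_norm.
Qed.

Lemma integral_pieces_S (h : R -> R) : measurable_fun I h -> (forall t, I t -> 0 <= h t) ->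
  (\sum_(1 <= i < n.+1) \int[mu]_(s in piece i) ((S i (linv i s) * h (linv i s)) `^ p)%:E <=
   c%:E * \int[mu]_(t in I) (h t `^ p)%:E)%E.
Proof.
move=> mh h0; rewrite -sum_normE ge0_sume_distrl; last by move=> i _; exact: norm_ge0.
rewrite !big_seq; apply: lee_sum => i; rewrite mem_index_iota ltnS => i1.
exact: integral_piece_S.
Qed.

(** Here the weight after substitution is [Dl i] alone, which is essentially bounded. *)
Lemma integral_piece_q i : (1 <= i <= n)%N ->
  (\int[mu]_(s in piece i) ((q i (linv i s)) `^ p)%:E < +oo)%E.
Proof.
move=> i1; have [mq [q0' q_fin]] := q_Lp i i1; have [_ [mDl [Dl0 Dl_fin]]] := deriv i i1.
have mqp : measurable_fun I (fun t => (q i t `^ p)%:E) by exact: measurable_EFin_powR.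
have := integral_piece_le i (fun t => (q i t `^ p)%:E) i1 mqp.
move=> /(_ (fun t _ => powR_ge0 _ _)) /le_lt_trans; apply.
set M := esssup_on I (fun t => `|Dl i t|) in Dl_fin.
have M0 : (0 <= M)%E by apply: esssup_on_ge0.
have M_fin : M \is a fin_num by rewrite ge0_fin_numE.
apply: (@le_lt_trans _ _ (M * \int[mu]_(t in I) (q i t `^ p)%:E)%E); last first.
  rewrite -(fineK M_fin); apply: lte_mul_pinfty; [by rewrite lee_fin fine_ge0|by []|].
  apply: le_lt_trans q_fin; apply: ge0_le_integral => //.
  - exact: measurable_cI.
  - by move=> t _; rewrite lee_fin powR_ge0.
  - by apply: measurable_EFin_powR; exact: measurableT_comp.
  - by move=> t It; rewrite ger0_norm ?q0'.
rewrite -ge0_integralZl//; last 2 first.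
- exact: measurable_cI.
- by move=> t _; rewrite lee_fin powR_ge0.
apply: ae_ge0_le_integral.
- exact: measurable_cI.
- by move=> t It; rewrite -EFinM lee_fin mulr_ge0 ?powR_ge0 ?Dl0.
- by apply: emeasurable_funM => //; exact/measurable_EFinP.
- by move=> t It; rewrite mule_ge0// lee_fin powR_ge0.
- exact: emeasurable_funM.
apply: lebesgue_ae_mono (esssup_on_le I (fun t => `|Dl i t|)) => t /[swap] It /(_ It) norm_t.
rewrite muleC; apply: lee_wpmul2r; first by rewrite lee_fin powR_ge0.
by apply: le_trans norm_t; rewrite lee_fin ler_norm.
Qed.

(** The terms in [q i] cancel in the difference, so [integral_pieces_S] applies to |f - g|. *)
Lemma RB_op_contraction f g : Lp_plus p I f -> Lp_plus p I g ->
  (dp p I (T f) (T g) <= c%:E * dp p I f g)%E.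
Proof.
move=> [mf [f0 _]] [mg [g0 _]]; rewrite /dp.
have mabs : measurable_fun I (fun t => `|f t - g t|).
  by apply: measurableT_comp => //; exact: measurable_funB.
have mTabs : measurable_fun I (fun t => `|T f t - T g t|).
  by apply: measurableT_comp => //; apply: measurable_funB; exact: measurable_RB_op.
under eq_integral do rewrite max_sub_minE.
under [X in (_ <= _ * X)%E]eq_integral do rewrite max_sub_minE.
apply: le_trans (integral_pieces_S _ mabs (fun t _ => normr_ge0 _)).
rewrite (integral_partition x_incr _ n0 (measurable_EFin_powR _ _ mTabs) (fun t _ => powR_ge0 _ _)).
rewrite big_seq [X in (_ <= X)%E]big_seq; apply: lee_sum => i.
rewrite mem_index_iota ltnS => i1; rewrite le_eqVlt; apply/orP; left.
apply/eqP/eq_integral => t /set_mem it.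
rewrite !(RB_opE i)// opprD addrACA subrr add0r -mulrBr normrM.
have [_ [S0 _]] := S_Linf i i1.
by rewrite (ger0_norm (S0 _ _))//; exact: linv_in.
Qed.

(** An affine recursion of slope below 1 for the integral of the [p]-th power, which keeps it
    bounded along the iterates. The part with [S] contributes the factor [c], and the constants of
    [powRD_le_contract] leave room for it. *)
Lemma RB_op_bound : exists Q B : R, [/\ 0 <= Q, 0 <= B, B < 1 &
  forall g : R -> R, measurable_fun I g -> (forall t, I t -> 0 <= g t) ->
    (\int[mu]_(t in I) (T g t `^ p)%:E <=
     Q%:E + B%:E * \int[mu]_(t in I) (g t `^ p)%:E)%E].
Proof.
have [A [B [A0 B0 Bc ineq]]] := powRD_le_contract p c p0 contraction_bound.
have [c0 c1] := andP contraction_bound.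
pose Q := (\sum_(1 <= i < n.+1) \int[mu]_(s in piece i) ((q i (linv i s)) `^ p)%:E)%E.
have Q0 : (0 <= Q)%E.
  by apply: sume_ge0 => i _; apply: integral_ge0 => t _; rewrite lee_fin powR_ge0.
have Q_fin : Q \is a fin_num.
  rewrite ge0_fin_numE// /Q big_seq; apply: lte_sum_pinfty => i.
  by rewrite mem_index_iota ltnS; exact: integral_piece_q.
exists (A * fine Q), (B * c); split => //.
- by rewrite mulr_ge0// fine_ge0.
- exact: mulr_ge0.
move=> g mg g0; have mTg : measurable_fun I (fun t => (T g t `^ p)%:E).
  by apply: measurable_EFin_powR; exact: measurable_RB_op.
rewrite (integral_partition x_incr _ n0 mTg (fun t _ => powR_ge0 _ _)).
rewrite !EFinM fineK// -muleA.
apply: (@le_trans _ _ (A%:E * Q + B%:E * \sum_(1 <= i < n.+1)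
    \int[mu]_(s in piece i) ((S i (linv i s) * g (linv i s)) `^ p)%:E)%E); last first.
  by apply: leeD => //; apply: lee_wpmul2l => //; exact: integral_pieces_S.
rewrite !ge0_sume_distrr; last 2 first.
- by move=> i _; apply: integral_ge0 => t _; rewrite lee_fin powR_ge0.
- by move=> i _; apply: integral_ge0 => t _; rewrite lee_fin powR_ge0.
rewrite -big_split/= big_seq [X in (_ <= X)%E]big_seq; apply: lee_sum => i.
rewrite mem_index_iota ltnS => i1.
have [mq [q0' _]] := q_Lp i i1; have [mS [S0 _]] := S_Linf i i1.
have mqi : measurable_fun (piece i) (fun s => ((q i (linv i s)) `^ p)%:E).
  by apply: measurable_EFin_powR; exact: measurable_comp_linv.
have mSi : measurable_fun (piece i) (fun s => ((S i (linv i s) * g (linv i s)) `^ p)%:E).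
  by apply: measurable_EFin_powR; apply: measurable_funM; exact: measurable_comp_linv.
rewrite -!ge0_integralZl//; try exact: measurable_Isub;
  try by move=> t _; rewrite lee_fin powR_ge0.
rewrite -ge0_integralD//; first last.
- by apply: emeasurable_funM.
- by move=> t _; rewrite mule_ge0// lee_fin powR_ge0.
- by apply: emeasurable_funM.
- by move=> t _; rewrite mule_ge0// lee_fin powR_ge0.
- exact: measurable_Isub.
apply: ge0_le_integral.
- exact: measurable_Isub.
- by move=> t _; rewrite lee_fin powR_ge0.
- apply: measurable_funS (measurable_EFin_powR _ _ (measurable_RB_op g mg)).
    exact: measurable_cI.
  by move=> t; exact: piece_I.
- by apply: emeasurable_funD; exact: emeasurable_funM.
- move=> t it; rewrite (RB_opE i)// -!EFinM -EFinD lee_fin; apply: ineq.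
    by apply: q0'; exact: linv_in.
  by rewrite mulr_ge0 ?S0 ?g0//; exact: linv_in.
Qed.


Lemma measurable_dp_integrand (f g : R -> R) : measurable_fun I f -> measurable_fun I g ->
  measurable_fun I (fun t => ((Num.max (f t) (g t) - Num.min (f t) (g t)) `^ p)%:E).
Proof.
move=> mf mg; apply: measurable_EFin_powR; apply: measurable_funB.
  exact: measurable_maxr.
exact: measurable_minr.
Qed.

(** For nonnegative values |f - g| is at most the larger of the two, so its [p]-th power is at most
    the sum of the two powers. *)
Lemma dp_fin f g : Lp_plus p I f -> Lp_plus p I g -> (dp p I f g < +oo)%E.
Proof.
move=> [mf [f0 f_fin]] [mg [g0 g_fin]]; rewrite /dp.
apply: (@le_lt_trans _ _ (\int[mu]_(t in I) ((`|f t| `^ p)%:E + (`|g t| `^ p)%:E))%E).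
  apply: ge0_le_integral.
  - exact: measurable_cI.
  - by move=> t _; rewrite lee_fin powR_ge0.
  - exact: measurable_dp_integrand.
  - by apply: emeasurable_funD; apply: measurable_EFin_powR; exact: measurableT_comp.
  - move=> t It; rewrite -EFinD lee_fin max_sub_minE.
    have [ft gt] := (f0 _ It, g0 _ It); rewrite (ger0_norm ft) (ger0_norm gt).
    have [fg|gf] := leP (f t) (g t).
      apply: (@le_trans _ _ (g t `^ p)); last by rewrite lerDr powR_ge0.
      apply: ge0_ler_powR; rewrite ?nnegrE// ?(ltW p0)//.
      by rewrite distrC ger0_norm ?subr_ge0// lerBlDr lerDl.
    apply: (@le_trans _ _ (f t `^ p)); last by rewrite lerDl powR_ge0.
    apply: ge0_ler_powR; rewrite ?nnegrE// ?(ltW p0)//.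
    by rewrite ger0_norm ?subr_ge0 ?(ltW gf)// lerBlDr lerDl.
rewrite ge0_integralD//.
- by apply: lte_add_pinfty; [exact: f_fin|exact: g_fin].
- exact: measurable_cI.
- by apply: measurable_EFin_powR; exact: measurableT_comp.
- by apply: measurable_EFin_powR; exact: measurableT_comp.
Qed.

Lemma RB_op_Lp g : Lp_plus p I g -> Lp_plus p I (T g).
Proof.
move=> [mg [g0 g_fin]]; have Tg0 := RB_op_ge0 g g0.
have normE (h : R -> R) : (forall t, I t -> 0 <= h t) ->
    (\int[mu]_(t in I) (`|h t| `^ p)%:E = \int[mu]_(t in I) (h t `^ p)%:E)%E.
  by move=> h0; apply: eq_integral => t /set_mem It; rewrite ger0_norm// h0.
split; first exact: measurable_RB_op.
split; first exact: Tg0.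
have [Q [B [_ B0 _ bound]]] := RB_op_bound.
rewrite (normE _ Tg0); apply: le_lt_trans (bound g mg g0) _.
rewrite -(normE _ g0); apply: lte_add_pinfty; first exact: ltry.
by apply: lte_mul_pinfty; [rewrite lee_fin|by []|exact: g_fin].
Qed.

Lemma dp_eq0 f g : Lp_plus p I f -> Lp_plus p I g -> dp p I f g = 0%E -> ae_eq_on I f g.
Proof.
move=> [mf _] [mg _] fg0.
have mh := measurable_dp_integrand f g mf mg.
have [+ _] := @ae_eq_integral_abs _ (measurableTypeR R) R mu I (measurable_cI _ _) _ mh.
have h0 : (\int[mu]_(t in I)
    `|((Num.max (f t) (g t) - Num.min (f t) (g t)) `^ p)%:E| = 0)%E.
  by rewrite -[RHS]fg0; apply: eq_integral => t _; rewrite gee0_abs// lee_fin powR_ge0.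
move=> /(_ h0); apply: lebesgue_ae_mono => t /[apply] -[] /eqP.
by rewrite powR_eq0 max_sub_minE normr_eq0 subr_eq0 => /andP[/eqP].
Qed.

(** The distance [d] between two fixed points satisfies [d <= c * d]; being finite, it is 0. *)
Lemma fixed_point_unique f g : Lp_plus p I f -> Lp_plus p I g ->
  ae_eq_on I (T f) f -> ae_eq_on I (T g) g -> ae_eq_on I g f.
Proof.
move=> Lf Lg fix_f fix_g; apply: dp_eq0 => //.
have dTE : dp p I (T g) (T f) = dp p I g f.
  apply: ae_eq_integral.
  - exact: measurable_cI.
  - by apply: measurable_dp_integrand; apply: measurable_RB_op; [case: Lg|case: Lf].
  - by apply: measurable_dp_integrand; [case: Lg|case: Lf].
  - have := lebesgue_ae_and _ _ fix_f fix_g; apply: lebesgue_ae_mono => t [ft gt] It.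
    by rewrite ft// gt.
have := RB_op_contraction g f Lg Lf; rewrite dTE.
have [c0 c1] := andP contraction_bound.
have d0 : (0 <= dp p I g f)%E by apply: integral_ge0 => t _; rewrite lee_fin powR_ge0.
have d_fin : dp p I g f \is a fin_num by rewrite (ge0_fin_numE d0); exact: dp_fin.
rewrite -(fineK d_fin) -EFinM lee_fin => dcd.
have {}d0 : 0 <= fine (dp p I g f) by exact: fine_ge0.
congr EFin; apply: le_anti; rewrite d0 andbT.
have c10 : 0 < 1 - c by rewrite subr_gt0.
rewrite -(pmulr_rle0 _ c10).
by rewrite mulrBl mul1r subr_le0.
Qed.

(** Each [l i] carries null sets to null sets, so almost every point has its preimage outside the
    exceptional set of its piece. *)
Lemma ae_pieces (N : nat -> set R) : (forall i, (1 <= i <= n)%N -> mu.-negligible (N i)) ->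
  {ae mu, forall s : R, I s -> exists i, [/\ (1 <= i <= n)%N, piece i s & ~ N i (linv i s)]}.
Proof.
move=> N0; pose B i := [set s | (1 <= i <= n)%N /\ piece i s /\ N i (linv i s)].
have : mu.-negligible (\bigcup_i B i).
  apply: negligible_bigcup => i; have [i1|i1] := boolP (1 <= i <= n)%N.
    by apply: negligibleS (negligible_comp_linv i (N i) i1 (N0 i i1)) => s [].
  by apply: negligibleS (negligible_set0 _) => s [i2]; rewrite i2 in i1.
apply: negligibleS => s /= /not_implyP[Is nex].
have [i i1 is_] := Isub_cover s n0 Is; exists i => //; split => //; split => //.
by apply: contrapT => Ns; apply: nex; exists i.
Qed.

(** * Monotone iteration from zero *)

Let u k : R -> R := iter k T (fun=> 0).

Let measurable_u k : measurable_fun I (u k).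
Proof. by elim: k => [|k IH]; [exact: measurable_cst|exact: measurable_RB_op]. Qed.

Let u_ge0 k t : I t -> 0 <= u k t.
Proof. by elim: k t => [//|k IH] t It; exact: RB_op_ge0 IH t It. Qed.

Let u_nd t : I t -> {homo u ^~ t : j k / (j <= k)%N >-> j <= k}.
Proof.
move=> It; apply/nondecreasing_seqP => k; elim: k t It => [|k IH] t It.
  exact: (u_ge0 1).
exact: RB_op_le IH t It.
Qed.

Let u_Lp_bound : exists K : R, forall k, (\int[mu]_(t in I) (u k t `^ p)%:E <= K%:E)%E.
Proof.
have [Q [B [Q0 B0 B1 bound]]] := RB_op_bound.
have B10 : 0 < 1 - B by rewrite subr_gt0.
(* This is the fixed point of [K |-> Q + B * K], so the bound passes from each iterate to the
   next. *)
exists (Q / (1 - B)); elim => [|k IH].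
  rewrite integral0_eq ?lee_fin ?divr_ge0 ?(ltW B10)// => t _.
  by rewrite /u/= powR0// gt_eqF.
apply: le_trans (bound _ (measurable_u k) (fun t => u_ge0 k t)) _.
apply: (@le_trans _ _ (Q%:E + B%:E * (Q / (1 - B))%:E)%E).
  by apply: leeD => //; apply: lee_wpmul2l.
rewrite -EFinM -EFinD lee_fin le_eqVlt; apply/orP; left; apply/eqP.
by field; rewrite gt_eqF.
Qed.

(** Taken in the extended reals, where a monotone limit always exists; the iterates converge
    wherever it is finite. *)
Let P t : \bar R := limn (fun k => (u k t `^ p)%:E).

Let up_nd t : I t -> {homo (fun k => (u k t `^ p)%:E) : j k / (j <= k)%N >-> (j <= k)%E}.
Proof.
move=> It j k jk; rewrite lee_fin; apply: ge0_ler_powR; rewrite ?nnegrE ?u_ge0 ?(ltW p0)//.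
exact: u_nd.
Qed.

Let up_cvg t : I t -> (fun k => (u k t `^ p)%:E) @ \oo --> P t.
Proof. by move=> It; apply: ereal_nondecreasing_is_cvgn; exact: up_nd. Qed.

Let up_le t k : I t -> ((u k t `^ p)%:E <= P t)%E.
Proof.
move=> It; rewrite -(cvg_lim _ (up_cvg t It))//.
apply: lime_ge; first by apply/cvg_ex; exists (P t); exact: up_cvg.
by near=> j; apply: up_nd => //; near: j; exists k.
Unshelve. all: by end_near. Qed.

Let mP : measurable_fun I P.
Proof.
apply: (emeasurable_fun_cvg (fun k t => (u k t `^ p)%:E)) => [k|t It].
  exact: measurable_EFin_powR.
exact: up_cvg.
Qed.

Let P_ge0 t : I t -> (0 <= P t)%E.
Proof. by move=> It; apply: le_trans (up_le t 0 It); rewrite lee_fin powR_ge0. Qed.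

Let integral_P : (\int[mu]_(t in I) P t < +oo)%E.
Proof.
have [K uK] := u_Lp_bound; apply: (@le_lt_trans _ _ K%:E); last exact: ltry.
rewrite (monotone_convergence mu (measurable_cI _ _)).
- apply: lime_le; last exact: nearW.
  apply: ereal_nondecreasing_is_cvgn => j k jk; apply: ge0_le_integral => //.
  + exact: measurable_cI.
  + by move=> t _; rewrite lee_fin powR_ge0.
  + exact: measurable_EFin_powR.
  + exact: measurable_EFin_powR.
  + by move=> t It; exact: up_nd.
- by move=> k; exact: measurable_EFin_powR.
- by move=> k t _; rewrite lee_fin powR_ge0.
- by move=> t It; exact: up_nd.
Qed.

Let P_fin : {ae mu, forall t : R, I t -> (P t < +oo)%E}.
Proof.
have iP : mu.-integrable I P.
  apply/integrableP; split => //.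
  by under eq_integral => t /set_mem It do rewrite gee0_abs ?P_ge0//.
have := @integrable_ae _ (measurableTypeR R) R mu I (measurable_cI _ _) P iP.
by apply: lebesgue_ae_mono => t /[apply]; rewrite fin_numElt => /andP[].
Qed.

(** Where the iterates diverge to [+oo], [fine] returns 0, so [fstar] is nonnegative on all of
    [I]. *)
Let fstar t : R := fine (limn (fun k => (u k t)%:E)).

Let fstarE t v : u ^~ t @ \oo --> v -> fstar t = v.
Proof.
move=> uv; rewrite /fstar; have -> // : limn (fun k => (u k t)%:E) = v%:E.
by apply/cvg_lim => //; apply: cvg_EFin => //; exact: nearW.
Qed.

Let u_le_root t k : I t -> (P t < +oo)%E -> u k t <= fine (P t) `^ p^-1.
Proof.
move=> It Pfin; have Pt := up_le t k It.
have P_num : P t \is a fin_num by rewrite ge0_fin_numE ?P_ge0.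
move: Pt; rewrite -(fineK P_num) lee_fin => Pt.
have -> : u k t = (u k t `^ p) `^ p^-1.
  by rewrite -powRrM mulfV ?gt_eqF// powRr1 ?u_ge0.
by apply: ge0_ler_powR Pt;
  rewrite ?nnegrE ?powR_ge0 ?invr_ge0 ?(ltW p0) ?fine_ge0 ?P_ge0.
Qed.

Let fstar_cvg t : I t -> (P t < +oo)%E -> u ^~ t @ \oo --> fstar t.
Proof.
move=> It Pfin; have u_cvg : cvgn (u ^~ t).
  apply: nondecreasing_is_cvgn; first exact: u_nd.
  by exists (fine (P t) `^ p^-1) => _ [k _ <-]; exact: u_le_root.
by rewrite (fstarE t (limn (u ^~ t))).
Qed.

Let fstar_ge0 t : I t -> 0 <= fstar t.
Proof.
move=> It; apply: fine_ge0; apply: lime_ge.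
  by apply: ereal_nondecreasing_is_cvgn => j k jk; rewrite lee_fin u_nd.
by apply: nearW => k; rewrite lee_fin u_ge0.
Qed.

Let mfstar : measurable_fun I fstar.
Proof.
apply: (measurableT_comp (fine_measurable measurableT)).
apply: (emeasurable_fun_cvg (fun k t => (u k t)%:E)) => [k|t It].
  exact/measurable_EFinP.
by apply: ereal_nondecreasing_is_cvgn => j k jk; rewrite lee_fin u_nd.
Qed.

(** Almost everywhere the [p]-th power of [fstar] is at most the integrable function [P]. *)
Let fstar_Lp : Lp_plus p I fstar.
Proof.
split=> //; split=> //; apply: le_lt_trans integral_P.
apply: ae_ge0_le_integral.
- exact: measurable_cI.
- by move=> t _; rewrite lee_fin powR_ge0.
- by apply: measurable_EFin_powR; exact: measurableT_comp.
- exact: P_ge0.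
- exact: mP.
apply: lebesgue_ae_mono P_fin => t Pfin It; have {}Pfin := Pfin It.
have P_num : P t \is a fin_num by rewrite ge0_fin_numE ?P_ge0.
have fP0 : 0 <= fine (P t) by rewrite fine_ge0 ?P_ge0.
have fs_le : fstar t <= fine (P t) `^ p^-1.
  have fs := fstar_cvg t It Pfin; rewrite -(cvg_lim _ fs)//.
  apply: limr_le; first by apply/cvg_ex; exists (fstar t).
  by apply: nearW => k; exact: u_le_root.
rewrite -[leRHS](fineK P_num) lee_fin ger0_norm ?fstar_ge0//.
have -> : fine (P t) = (fine (P t) `^ p^-1) `^ p.
  by rewrite -powRrM mulVf ?gt_eqF// powRr1.
by apply: ge0_ler_powR fs_le; rewrite ?nnegrE ?powR_ge0 ?fstar_ge0 ?(ltW p0).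
Qed.

(** Iterate [k + 1] at [l i t] is an affine function of iterate [k] at [t], so convergence at
    [l i t] is inherited from [t]; only [t] has to avoid the null set. *)
Let fstar_step i t : (1 <= i <= n)%N -> I t -> (P t < +oo)%E -> piece i (l i t) ->
  fstar (l i t) = q i t + S i t * fstar t.
Proof.
move=> i1 It Pfin lit; apply: fstarE.
have [_ [_ [_ [_ [lK _]]]]] := homeo i i1.
rewrite -cvg_shiftS /=.
have -> : (fun k => T (u k) (l i t)) = (fun k => q i t + S i t * u k t).
  by apply/funext => k; rewrite (RB_opE i)// lK.
have Su : (fun k => S i t * u k t) @ \oo --> S i t * fstar t.
  by apply: cvgM; [exact: cvg_cst|exact: fstar_cvg].
exact: (cvgD (cvg_cst (q i t)) Su).
Qed.

(* Stronger than [T f = f] a.e.: the preimage of a null set under [l i] need not be null. *)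
Lemma RB_op_pointwise_fixed_point : exists (f : R -> R) (N : set R),
  [/\ Lp_plus p I f, mu.-negligible N &
      forall i t, (1 <= i <= n)%N -> I t -> ~ N t -> piece i (l i t) ->
        f (l i t) = q i t + S i t * f t].
Proof.
exists fstar, [set t | I t /\ ~ (P t < +oo)%E]; split=> //.
  by apply: negligibleS P_fin => t [It Pt] /= /(_ It).
move=> i t i1 It NPt lit; apply: fstar_step => //.
by apply: contrapT => Pt; apply: NPt.
Qed.

(** * The graph of the fixed point as an attractor *)

Section graph_attractor.
Context {f : R -> R} {N : set R}.
Hypothesis f_Lp : Lp_plus p I f.
Hypothesis N_null : mu.-negligible N.
Hypothesis f_fix : forall i t, (1 <= i <= n)%N -> I t -> ~ N t -> piece i (l i t) ->
  f (l i t) = q i t + S i t * f t.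

Lemma RB_op_ae_fixed : ae_eq_on I (T f) f.
Proof.
have := ae_pieces (fun=> N) (fun _ _ => N_null).
apply: lebesgue_ae_mono => s /[apply] -[i [i1 is_ Nlinv]].
have [_ [_ [_ [_ [_ linvK]]]]] := homeo i i1.
have ls : l i (linv i s) = s by apply: linvK; exact: Isub_sub is_.
have := f_fix i (linv i s) i1 (linv_in i s i1 is_) Nlinv.
by rewrite ls (RB_opE i)// => /(_ is_) ->.
Qed.

(** Where the functional equation fails, [S'] is 0 and [q'] is the required value [f (l i t)], so
    that it holds at every [t]. This includes [x n], whose image may be a node belonging to the next
    piece. *)
Let ok i t : bool := `[< f (l i t) = q i t + S i t * f t >].
Let q' i t := if ok i t then q i t else f (l i t).
Let S' i t := if ok i t then S i t else 0.

(** By injectivity only [x n] is sent to the right endpoint, which every piece but the last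
    omits. *)
Let l_piece i t : (1 <= i <= n)%N -> I t -> t != x n -> piece i (l i t).
Proof.
move=> i1 It txn; have [_ [_ [l_J [_ [lK _]]]]] := homeo i i1.
have [_ l_b] := l_end i i1; have /andP[c1 c2] := l_J t It.
rewrite /Isub; case: ltnP => _; last exact: l_J.
rewrite /= c1/= lt_neqAle c2 andbT; apply: contra_not_neq (elimN eqP txn) => litE.
rewrite -(lK t It) litE -l_b lK//.
by rewrite /cI/= lexx (ltW nodes_lt).
Qed.

Let ok_ae i : (1 <= i <= n)%N -> {ae mu, forall t : R, I t -> ok i t}.
Proof.
move=> i1; have neg : mu.-negligible (N `|` [set x n]).
  apply: negligibleU => //; apply/negligibleP => //; exact: lebesgue_measure_set1.
apply: negligibleS neg => t /= /not_implyP[It nok].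
have [->|txn] := eqVneq t (x n); [by right|left].
apply: contrapT => Nt; apply: nok; apply/asboolP.
by apply: f_fix => //; exact: l_piece.
Qed.

Let step i t : f (l i t) = q' i t + S' i t * f t.
Proof. by rewrite /q' /S' /ok; case: asboolP => [//|_]; rewrite mul0r addr0. Qed.

Lemma RB_op_graph_attractor : exists q' S' : nat -> R -> R,
  [/\ forall i, (1 <= i <= n)%N -> ae_eq_on I (q' i) (q i) /\ ae_eq_on I (S' i) (S i) /\
         forall t, I t -> 0 <= q' i t /\ 0 <= S' i t,
      graph_on I f = hutchinson n l q' S' (graph_on I f) &
      forall g, Lp_plus p I g -> graph_on I g = hutchinson n l q' S' (graph_on I g) ->
        ae_eq_on I (T g) g].
Proof.
have l_I i t : (1 <= i <= n)%N -> I t -> I (l i t).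
  move=> i1 It; have [_ [_ [l_J _]]] := homeo i i1.
  by apply: (node_interval_sub x_incr i i1); exact: l_J.
have f0 : forall t, I t -> 0 <= f t by case: f_Lp => _ [].
exists q', S'; split.
- move=> i i1; split.
    by apply: lebesgue_ae_mono (ok_ae i i1) => t /[apply]; rewrite /q' => ->.
  split.
    by apply: lebesgue_ae_mono (ok_ae i i1) => t /[apply]; rewrite /S' => ->.
  have [_ [q0 _]] := q_Lp i i1; have [_ [S0 _]] := S_Linf i i1.
  move=> t It; rewrite /q' /S'; case: ifP => _; first by rewrite q0 ?S0.
  by split=> //; apply: f0; exact: l_I.
- apply/seteqP; split => [[s y] [/= Is] /= ->|_ [i /= i1] [[t y] [/= It] /= -> <-]].
    have [i i1 is_] := Isub_cover s n0 Is; have [_ [_ [_ [_ [_ linvK]]]]] := homeo i i1.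
    have ls : l i (linv i s) = s by apply: linvK; exact: Isub_sub is_.
    exists i => //; exists (linv i s, f (linv i s)) => /=; first by split=> //; exact: linv_in.
    by rewrite -step ls.
  by split=> /=; [exact: l_I|rewrite step].
- move=> g Lg gE.
  (* A graph has one point above [l i t], so its invariance yields the functional equation for [g]
     with [q'] and [S'] at every point of [I]. *)
  have g_step i t : (1 <= i <= n)%N -> I t -> g (l i t) = q' i t + S' i t * g t.
    move=> i1 It; have : hutchinson n l q' S' (graph_on I g) (l i t, q' i t + S' i t * g t).
      by exists i => //; exists (t, g t).
    by rewrite -gE => -[].
  (* Almost every [s] has its preimage where [q'] and [S'] agree with [q] and [S]. *)
  have := ae_pieces (fun i => [set t | ~ (I t -> ok i t)]) ok_ae.
  apply: lebesgue_ae_mono => s /[apply] -[i [i1 is_ /contrapT okl]].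
  have [_ [_ [_ [_ [_ linvK]]]]] := homeo i i1.
  have ls : l i (linv i s) = s by apply: linvK; exact: Isub_sub is_.
  have Il := linv_in i s i1 is_.
  by rewrite -[in RHS]ls g_step// (RB_opE i)// /q' /S' (okl Il).
Qed.

End graph_attractor.

End read_bajraktarevic.

Theorem theorem5p1 (R : realType) (n : nat) (x : nat -> R) (p : R)
  (l linv Dl q S : nat -> R -> R) :
  (0 < n)%N ->
  0 <= x 0%N ->
  (forall k, (k < n)%N -> x k < x k.+1) ->
  1 <= p ->
  (* l_i : I -> [x_{i-1}, x_i] homeomorphism with inverse linv i *)
  (forall i, (1 <= i <= n)%N ->
     {within cI (x 0%N) (x n), continuous (l i : R -> R)} /\
     {within cI (x i.-1) (x i), continuous (linv i : R -> R)} /\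
     (forall t, cI (x 0%N) (x n) t -> cI (x i.-1) (x i) (l i t)) /\
     (forall s, cI (x i.-1) (x i) s -> cI (x 0%N) (x n) (linv i s)) /\
     (forall t, cI (x 0%N) (x n) t -> linv i (l i t) = t) /\
     (forall s, cI (x i.-1) (x i) s -> l i (linv i s) = s)) ->
  (* contractive *)
  (forall i, (1 <= i <= n)%N -> exists c : R, c < 1 /\
     forall t u, cI (x 0%N) (x n) t -> cI (x 0%N) (x n) u ->
       `|l i t - l i u| <= c * `|t - u|) ->
  (forall i, (1 <= i <= n)%N -> l i (x 0%N) = x i.-1 /\ l i (x n) = x i) ->
  (* derivative Dl_i exists (on the interior of I) and lies in L_oo^+ I *)
  (forall i, (1 <= i <= n)%N ->
     (forall t, x 0%N < t < x n -> is_derive t 1 (l i) (Dl i t)) /\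
     Linf_plus (cI (x 0%N) (x n)) (Dl i)) ->
  (forall i, (1 <= i <= n)%N -> Lp_plus p (cI (x 0%N) (x n)) (q i)) ->
  (forall i, (1 <= i <= n)%N -> Linf_plus (cI (x 0%N) (x n)) (S i)) ->
  (\sum_(1 <= i < n.+1)
      esssup_on (cI (x 0%N) (x n)) (fun t => `|Dl i t * S i t `^ p|%R) < 1)%E ->
  let I := cI (x 0%N) (x n) in
  let T := RB_op x n linv q S in
  (* T maps L_p^+ I into itself *)
  (forall g, Lp_plus p I g -> Lp_plus p I (T g)) /\
  (* T is contractive w.r.t. d_p *)
  (exists c : R, 0 <= c < 1 /\
     forall f g, Lp_plus p I f -> Lp_plus p I g ->
       (dp p I (T f) (T g) <= c%:E * dp p I f g)%E) /\
  (* unique fixed point f*, satisfying the self-referential equation *)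
  (exists fstar : R -> R,
     [/\ Lp_plus p I fstar,
         ae_eq_on I (T fstar) fstar,
         (forall g, Lp_plus p I g -> ae_eq_on I (T g) g -> ae_eq_on I g fstar),
         {ae (@lebesgue_measure R), forall t, I t ->
            fstar t = \sum_(1 <= i < n.+1) q i (linv i t) * \1_(Isub x n i) t
                    + \sum_(1 <= i < n.+1)
                        S i (linv i t) * fstar (linv i t) * \1_(Isub x n i) t} &
         (* the graph of (a representative of) f* is the attractor of the IFS
            w_i(x,y) = (l_i x, q_i x + S_i x * y) (for representatives of q_i, S_i) *)
         exists (f : R -> R) (q' S' : nat -> R -> R),
           [/\ ae_eq_on I f fstar,
               (forall t, I t -> 0 <= f t),
               (forall i, (1 <= i <= n)%N ->
                  ae_eq_on I (q' i) (q i) /\ ae_eq_on I (S' i) (S i) /\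
                  forall t, I t -> 0 <= q' i t /\ 0 <= S' i t),
               graph_on I f = hutchinson n l q' S' (graph_on I f) &
               (forall g, Lp_plus p I g ->
                  graph_on I g = hutchinson n l q' S' (graph_on I g) ->
                  ae_eq_on I g fstar)]]).
Proof.
move=> n0 _ x_incr p1 homeo contr l_end deriv q_Lp S_Linf small I T.
have unique := fixed_point_unique n0 x_incr p1 homeo contr l_end deriv q_Lp S_Linf small.
split.
  exact: (RB_op_Lp n0 x_incr p1 homeo contr l_end deriv q_Lp S_Linf small).
split.
  eexists; split; first exact: (contraction_bound n0 x_incr small).
  exact: (RB_op_contraction n0 x_incr homeo contr l_end deriv q_Lp S_Linf small).
have [f [N [f_Lp N_null f_fix]]] :=
  RB_op_pointwise_fixed_point n0 x_incr p1 homeo contr l_end deriv q_Lp S_Linf small.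
have f_ae := RB_op_ae_fixed n0 x_incr homeo contr l_end deriv N_null f_fix.
have [q' [S' [qS' f_graph g_graph]]] :=
  RB_op_graph_attractor n0 x_incr homeo contr l_end deriv q_Lp S_Linf f_Lp N_null f_fix.
exists f; split => //.
- by move=> g g_Lp; exact: unique.
- by apply: lebesgue_ae_mono f_ae => t /[apply] /esym.
(* The same [f] serves as the fixed point and as the representative whose graph is invariant. *)
- exists f, q', S'; split => //.
  + exact: aeW.
  + by case: f_Lp => _ [].
  + by move=> g g_Lp gE; apply: unique => //; exact: g_graph.
Qed.
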